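(* Let $A_{irr}(x,y)$ be the formal power series in which the coefficient of $x^n y^k$ is the number of absolutely irreducible $321$-avoiding permutations, other than the empty permutation, the permutation $1$ and the permutation $12$, having exactly $n$ left-to-right maxima and exactly $k$ other elements. Then $$(1+x)(1+y)\,A_{irr}^2+(xy-1)\,A_{irr}+xy=0 .$$ Consequently, the univariate generating function $A_{irr}(x)=A_{irr}(x,x)$, which counts these permutations by length, satisfies $$(x+1)^2A_{irr}^2+(x^2-1)A_{irr}+x^2=0 .$$
   Context: A permutation $\pi=p_1p_2\cdots p_m$ of $\{1,\dots,m\}$ is written in one-line notation. It avoids $321$ if there are no indices $i<j<k$ with $p_i>p_j>p_k$. An entry $p_i$ is a left-to-right maximum if $p_i>p_j$ for all $j<i$. A subword of $\pi$ means a contiguous block $p_ip_{i+1}\cdots p_j$ of entries; it is proper if it is not all of $\pi$. A permutation of length $m$ is absolutely irreducible if it has no proper subword of length greater than $1$ whose set of values is an interval (a set of consecutive integers) in $\{1,\dots,m\}$. (In particular $1$, $12$ and $21$ are absolutely irreducible; $21$ is counted by $A_{irr}(x,y)$.) *)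

(* Defs.v *)
From HB Require Import structures.
From mathcomp Require Import all_boot all_order all_fingroup all_algebra.
From mathcomp Require Import boolp.
Set Implicit Arguments.
Unset Strict Implicit.
Unset Printing Implicit Defensive.
Import GRing.Theory.
Local Open Scope ring_scope.

(* Permutations of {1, ..., m} are represented by s : 'S_m, with positions and
   values numbered from 0: s i is the entry in position i. *)

Definition avoids321 (m : nat) (s : 'S_m) : bool :=
  ~~ [exists i : 'I_m, exists j : 'I_m, exists k : 'I_m,
       [&& (i < j)%N, (j < k)%N, (s j < s i)%N & (s k < s j)%N]].

(* Left-to-right maxima are recorded by their positions. *)
Definition ltr_maxima (m : nat) (s : 'S_m) : {set 'I_m} :=
  [set i : 'I_m | [forall j : 'I_m, (j < i)%N ==> (s j < s i)%N]].

Definition segment (m : nat) (i j : 'I_m) : {set 'I_m} :=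
  [set k : 'I_m | (i <= k <= j)%N].

Definition is_interval (m : nat) (V : {set 'I_m}) : bool :=
  [exists a : 'I_m, exists b : 'I_m, V == segment a b].

(* The subword in positions i, ..., j has length greater than 1 iff i < j, and
   it is proper iff these are not all the positions. *)
Definition absolutely_irreducible (m : nat) (s : 'S_m) : bool :=
  ~~ [exists i : 'I_m, exists j : 'I_m,
       [&& (i < j)%N, segment i j \proper [set: 'I_m]
         & is_interval (s @: segment i j)]].

(* The empty permutation, 1 and 12; 'S_0 and 'S_1 have only one element. *)
Definition excluded (m : nat) (s : 'S_m) : bool :=
  [|| m == 0%N, m == 1%N | (m == 2%N) && (s == 1%g)].

Definition irr321 (m : nat) (s : 'S_m) : bool :=
  [&& absolutely_irreducible s, avoids321 s & ~~ excluded s].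

(* Formal power series in one variable. Series in x and y over R are series in
   x whose coefficients are series in y, i.e. elements of fps (fps R). *)
Record fps (R : Type) : Type := Fps { fps_coef : nat -> R }.

HB.instance Definition _ (R : Type) := gen_eqMixin (fps R).
HB.instance Definition _ (R : Type) := gen_choiceMixin (fps R).

Lemma fpsP (R : Type) (f g : fps R) : fps_coef f =1 fps_coef g -> f = g.
Proof. by case: f g => [f] [g] /= /funext ->. Qed.

Definition fps_zero (R : comNzRingType) : fps R := Fps (fun _ => 0).
Definition fps_opp (R : comNzRingType) (f : fps R) : fps R :=
  Fps (fun n => - fps_coef f n).
Definition fps_add (R : comNzRingType) (f g : fps R) : fps R :=
  Fps (fun n => fps_coef f n + fps_coef g n).

Definition fpsC (R : comNzRingType) (c : R) : fps R :=
  Fps (fun n => if n == 0%N then c else 0).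
Definition fps_mul (R : comNzRingType) (f g : fps R) : fps R :=
  Fps (fun n => \sum_(i < n.+1) fps_coef f i * fps_coef g (n - i)%N).

Lemma fps_addA (R : comNzRingType) : associative (@fps_add R).
Proof. by move=> f g h; apply: fpsP => n /=; rewrite addrA. Qed.
Lemma fps_addC (R : comNzRingType) : commutative (@fps_add R).
Proof. by move=> f g; apply: fpsP => n /=; rewrite addrC. Qed.
Lemma fps_add0 (R : comNzRingType) : left_id (@fps_zero R) (@fps_add R).
Proof. by move=> f; apply: fpsP => n /=; rewrite add0r. Qed.
Lemma fps_addN (R : comNzRingType) :
  left_inverse (@fps_zero R) (@fps_opp R) (@fps_add R).
Proof. by move=> f; apply: fpsP => n /=; rewrite addNr. Qed.

HB.instance Definition _ (R : comNzRingType) :=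
  GRing.isZmodule.Build (fps R)
    (@fps_addA R) (@fps_addC R) (@fps_add0 R) (@fps_addN R).

Definition fps_trunc (R : comNzRingType) (N : nat) (f : fps R) : {poly R} :=
  \poly_(i < N.+1) fps_coef f i.

Lemma coef_fps_trunc (R : comNzRingType) (N n : nat) (f : fps R) :
  (n <= N)%N -> (fps_trunc N f)`_n = fps_coef f n.
Proof. by move=> le_nN; rewrite coef_poly ltnS le_nN. Qed.

Lemma coef_fps_truncM (R : comNzRingType) (N n : nat) (f g : fps R) :
  (n <= N)%N ->
  (fps_trunc N f * fps_trunc N g)`_n = fps_coef (fps_mul f g) n.
Proof.
move=> le_nN; rewrite coefM; apply: eq_bigr => i _.
rewrite !coef_fps_trunc //; first exact: leq_trans (leq_subr _ _) le_nN.
by rewrite (leq_trans _ le_nN) // -ltnS.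
Qed.

Lemma fps_mulC (R : comNzRingType) : commutative (@fps_mul R).
Proof.
move=> f g; apply: fpsP => n.
by rewrite -!(coef_fps_truncM _ _ (leqnn n)) mulrC.
Qed.

Lemma fps_mulA (R : comNzRingType) : associative (@fps_mul R).
Proof.
move=> f g h; apply: fpsP => n.
have truncM (f1 f2 f3 : fps R) : fps_coef (fps_mul f1 (fps_mul f2 f3)) n
    = (fps_trunc n f1 * (fps_trunc n f2 * fps_trunc n f3))`_n.
  rewrite coefM; apply: eq_bigr => i _.
  by rewrite coef_fps_trunc ?coef_fps_truncM ?leq_subr // -ltnS.
by rewrite [in RHS]fps_mulC !truncM mulrA mulrC.
Qed.

Lemma fps_mul1 (R : comNzRingType) : left_id (fpsC 1) (@fps_mul R).
Proof.
move=> f; apply: fpsP => n /=.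
by rewrite big_ord_recl big1 /= ?mul1r ?subn0 ?addr0 // => i _; rewrite mul0r.
Qed.

Lemma fps_mulDl (R : comNzRingType) :
  left_distributive (@fps_mul R) (@fps_add R).
Proof.
move=> f g h; apply: fpsP => n /=; rewrite -big_split /=.
by apply: eq_bigr => i _; rewrite mulrDl.
Qed.

Lemma fps_1_neq0 (R : comNzRingType) : fpsC 1 != 0 :> fps R.
Proof.
apply/eqP => /(congr1 (fun f => fps_coef f 0)) /= /eqP.
by rewrite oner_eq0.
Qed.

HB.instance Definition _ (R : comNzRingType) :=
  GRing.Zmodule_isComNzRing.Build (fps R)
    (@fps_mulA R) (@fps_mulC R) (@fps_mul1 R) (@fps_mulDl R) (@fps_1_neq0 R).

Definition fpsX (R : comNzRingType) : fps R := Fps (fun n => (n == 1%N)%:R).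

Definition varX : fps (fps int) := fpsX (fps int).
Definition varY : fps (fps int) := fpsC (fpsX int).

(* The substitution y := x, mapping F(x, y) to F(x, x). *)
Definition fps_diag (R : comNzRingType) (F : fps (fps R)) : fps R :=
  Fps (fun m => \sum_(i < m.+1) fps_coef (fps_coef F i) (m - i)%N).

(* A permutation with n left-to-right maxima and k other elements has length
   n + k. *)
Definition Airr : fps (fps int) :=
  Fps (fun n => Fps (fun k =>
    (#|[set s : 'S_(n + k) | [&& irr321 s, #|ltr_maxima s| == n
                               & #|~: ltr_maxima s| == k]]|)%:R)).

Definition Airr1 : fps int := fps_diag Airr.

(* Main.v *)
Require Import Defs.
From HB Require Import structures.
From mathcomp Require Import all_boot all_order all_fingroup all_algebra.
From mathcomp Require Import boolp zify ring.
Import GRing.Theory.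
Local Open Scope ring_scope.
Set Implicit Arguments.
Unset Strict Implicit.
Unset Printing Implicit Defensive.

(** Let U_0, ..., U_(n-1) be the left-to-right maxima of a 321-avoiding
permutation and L_0, ..., L_(k-1) its other entries. Both lists increase in
position and in value, so the permutation is determined by the numbers a_j of
maxima standing to the left of L_j and b_j of maxima smaller than L_j. As
L_j is not a maximum, b_j < a_j, and the intervals [b_j, a_j) are the rows of a
figure with k rows and n columns: row j meets column i exactly when U_i and L_j
form an inversion. A proper subword with at least two entries whose values form
an interval either contains an inversion, and then the entries outside of it
split the figure, or it contains two adjacent equal rows or columns. Hence the
permutation is absolutely irreducible exactly when the figure is a
parallelogram polyomino in which adjacent rows differ and adjacent columns
differ ([blockless_polyomino], [polyomino_blockless], [card_irr321]).

Such polyominoes are counted in two steps. If only adjacent rows must differ,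
reading the figure row by row gives a three-term recurrence in the width w of
the current row. Its solution is determined by its value at w = 0, so it is the
w-th power of its value at w = 1, and the recurrence at w = 1 becomes a
quadratic equation ([rec_square], [row_reduced_eq]). To separate the columns as
well, one boundary between columns is treated at a time: figures in which a
given boundary separates nothing are those with one column less
([card_codesS]). So requiring the first q boundaries to separate amounts to
multiplying the series by (1 - x)^q, and requiring all n - 1 of them amounts to
the substitution of x / (1 + x) for x ([Airr_collapse]). This substitution, like
the later one of x for y, is a ring morphism ([fps_subst_mul]), so it carries
the quadratic equation along. *)

(** * Formal power series and substitutions *)

Section Series.
Variable R : comNzRingType.
Implicit Types (f g h : fps R) (c : R).

Lemma fps_coefD f g n : fps_coef (f + g) n = fps_coef f n + fps_coef g n.
Proof. by []. Qed.
Lemma fps_coefB f g n : fps_coef (f - g) n = fps_coef f n - fps_coef g n.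
Proof. by []. Qed.
Lemma fps_coefM f g n :
  fps_coef (f * g) n = \sum_(i < n.+1) fps_coef f i * fps_coef g (n - i)%N.
Proof. by []. Qed.
Lemma fps_coefC c n : fps_coef (fpsC c) n = if n == 0%N then c else 0.
Proof. by []. Qed.
Lemma fps_coef1 n : fps_coef (1 : fps R) n = (n == 0%N)%:R.
Proof. by rewrite [LHS]/=; case: (n == 0%N). Qed.

Lemma fps_coef_sum (I : Type) (r : seq I) (F : I -> fps R) n :
  fps_coef (\sum_(i <- r) F i) n = \sum_(i <- r) fps_coef (F i) n.
Proof. by elim/big_rec2: _ => // i y x _ <-. Qed.

Lemma fps_coefCM c f n : fps_coef (fpsC c * f) n = c * fps_coef f n.
Proof.
rewrite fps_coefM big_ord_recl big1 /= ?addr0 ?subn0 // => i _.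
by rewrite mul0r.
Qed.

Lemma fps_coefXM f n :
  fps_coef (fpsX R * f) n = if n is n'.+1 then fps_coef f n' else 0.
Proof.
rewrite fps_coefM big_ord_recl /= mul0r add0r.
case: n => [|n]; first by rewrite big_ord0.
rewrite big_ord_recl /= mul1r !subSS subn0 big1 ?addr0 // => i _.
by rewrite mul0r.
Qed.

Definition fps_shift f : fps R := Fps (fun n => fps_coef f n.+1).

Lemma fps_shiftE f : f = fpsC (fps_coef f 0%N) + fpsX R * fps_shift f.
Proof.
apply: fpsP => n; rewrite fps_coefD fps_coefXM fps_coefC.
by case: n => [|n] /=; rewrite ?addr0 ?add0r.
Qed.

Lemma fps_shiftM f g :
  f * g = fpsC (fps_coef f 0%N) * g + fpsX R * (fps_shift f * g).
Proof. by rewrite {1}[f]fps_shiftE mulrDl mulrA. Qed.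
End Series.

(** Such a map [phi] is the substitution of [g] for the variable. Peeling the
constant term off the first factor leaves a multiple of [g], and [g] has no
constant term: each coefficient of the product is reached by induction. *)
Lemma fps_subst_mul (R S : comNzRingType) (phi : fps R -> fps S) (g : fps S) :
    {morph phi : f h / f + h} ->
    (forall c f, phi (fpsC c * f) = phi (fpsC c) * phi f) ->
    (forall f, phi (fpsX R * f) = g * phi f) -> fps_coef g 0%N = 0 ->
  {morph phi : f h / f * h}.
Proof.
move=> phiD phiC phiX g0 f h; apply: fpsP => n.
have [m lt_nm] := ubnP n; elim: m => // m IHm in n f h lt_nm *.
rewrite fps_shiftM phiD phiC phiX [in phi f](fps_shiftE f) phiD phiX mulrDl.
rewrite -mulrA !fps_coefD; congr (_ + _).
rewrite !fps_coefM; apply: eq_bigr => -[[|i] lt_in] _ /=.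
  by rewrite g0 !mul0r.
by rewrite IHm //; lia.
Qed.

Section Collapse.
Variable R : comNzRingType.
Local Notation X := (fpsX R).

Lemma coef_pow_over (n q : nat) : (q < n)%N -> fps_coef ((1 - X) ^+ q) n = 0.
Proof.
elim: q n => [|q IHq] [|n] // lt_qn.
by rewrite exprS mulrBl mul1r fps_coefB fps_coefXM !IHq ?subr0 //; lia.
Qed.

(** The coefficient of x^n in f(x / (1 + x)) is that of x^n in (1 - x)^(n-1) f,
as Lagrange inversion shows; in this form it can be compared with
[card_codesS]. At n = 0 both are the constant term of f. *)
Definition collapse (f : fps R) : fps R :=
  Fps (fun n => fps_coef ((1 - X) ^+ n.-1 * f) n).

Lemma coef_collapse f n :
  fps_coef (collapse f) n = fps_coef ((1 - X) ^+ n.-1 * f) n.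
Proof. by []. Qed.

Lemma collapse1 : collapse 1 = 1.
Proof.
apply: fpsP => -[|n]; rewrite coef_collapse mulr1 ?expr0 //.
by rewrite coef_pow_over ?ltnSn.
Qed.

Lemma collapseD : {morph collapse : f h / f + h}.
Proof. by move=> f h; apply: fpsP => n;
  rewrite fps_coefD !coef_collapse mulrDr. Qed.

Lemma collapseC c f : collapse (fpsC c * f) = fpsC c * collapse f.
Proof. by apply: fpsP => n;
  rewrite fps_coefCM !coef_collapse mulrCA fps_coefCM. Qed.

(** Multiplicative form of collapse(x f) = x / (1 + x) * collapse(f). *)
Lemma collapseX f : (1 + X) * collapse (X * f) = X * collapse f.
Proof.
apply: fpsP => n; rewrite mulrDl mul1r fps_coefD !fps_coefXM.
case: n => [|n]; first by rewrite coef_collapse expr0 mul1r fps_coefXM addr0.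
rewrite !coef_collapse ![_ * (X * f)]mulrCA !fps_coefXM; case: n => [|n].
  by rewrite addr0.
rewrite exprS mulrBl mul1r mulrBl fps_coefB -[X * _ * f]mulrA fps_coefXM.
by rewrite subrK.
Qed.

Definition inv1X : fps R := Fps (fun n => (-1) ^+ n).

Lemma inv1XK : inv1X * (1 + X) = 1.
Proof.
apply: fpsP => n; rewrite mulrC mulrDl mul1r fps_coefD fps_coefXM fps_coef1.
by case: n => [|n] /=; rewrite ?addr0 // exprS mulN1r addNr.
Qed.

Lemma collapseM : {morph collapse : f h / f * h}.
Proof.
apply: (@fps_subst_mul _ _ _ (inv1X * X)) => [|c f|f|].
- exact: collapseD.
- by rewrite -[fpsC c in RHS]mulr1 !collapseC collapse1 mulr1.
- by rewrite -mulrA -collapseX mulrA inv1XK mul1r.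
- by rewrite mulrC fps_coefXM.
Qed.
End Collapse.

Section Diagonal.
Variable R : comNzRingType.

Lemma diagD : {morph @fps_diag R : F G / F + G}.
Proof. by move=> F G; apply: fpsP => m; rewrite /= -big_split. Qed.

Lemma diagC (c : fps R) : fps_diag (fpsC c) = c.
Proof.
apply: fpsP => m; rewrite /= big_ord_recl big1 ?addr0 ?subn0 //.
Qed.

Lemma fps_coefXnM (f : fps R) i n :
  fps_coef (fpsX R ^+ i * f) n = if (i <= n)%N then fps_coef f (n - i)%N else 0.
Proof.
elim: i n => [|i IHi] n; first by rewrite expr0 mul1r subn0.
by rewrite exprS -mulrA fps_coefXM; case: n => [|n] //; rewrite IHi.
Qed.

(** The diagonal is the sum of the x^i F_i, a finite sum as far as the
coefficients up to a given order are concerned. *)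
Lemma coef_diag (F : fps (fps R)) m N : (m <= N)%N ->
  fps_coef (fps_diag F) m =
    fps_coef (\sum_(i < N.+1) fpsX R ^+ i * fps_coef F i) m.
Proof.
move=> le_mN; rewrite [LHS]/= fps_coef_sum.
rewrite (big_ord_widen N.+1 (fun i => fps_coef (fps_coef F i) (m - i)%N)) //.
by rewrite big_mkcond; apply: eq_bigr => i _; rewrite fps_coefXnM ltnS.
Qed.

Lemma diagCM c (F : fps (fps R)) : fps_diag (fpsC c * F) = c * fps_diag F.
Proof.
apply: fpsP => m; rewrite (coef_diag _ (leqnn m)).
transitivity (fps_coef (c * \sum_(i < m.+1) fpsX R ^+ i * fps_coef F i) m).
  rewrite mulr_sumr !fps_coef_sum; apply: eq_bigr => i _.
  by rewrite fps_coefCM mulrCA.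
rewrite !fps_coefM; apply: eq_bigr => j _.
by rewrite (@coef_diag F _ m) ?leq_subr.
Qed.

Lemma fps_coef_diag (F : fps (fps R)) m :
  fps_coef (fps_diag F) m = \sum_(i < m.+1) fps_coef (fps_coef F i) (m - i)%N.
Proof. by []. Qed.

Lemma diagXM (F : fps (fps R)) :
  fps_diag (fpsX (fps R) * F) = fpsX R * fps_diag F.
Proof.
apply: fpsP => m; rewrite fps_coefXM.
case: m => [|m]; rewrite fps_coef_diag big_ord_recl fps_coefXM add0r.
  by rewrite big_ord0.
by apply: eq_bigr => i _; rewrite fps_coefXM.
Qed.

Lemma diagM : {morph @fps_diag R : F G / F * G}.
Proof.
apply: (@fps_subst_mul _ _ _ (fpsX R)) => [|c F|F|] //.
- exact: diagD.
- by rewrite diagCM diagC.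
- exact: diagXM.
Qed.

Lemma diag1 : fps_diag (1 : fps (fps R)) = 1.
Proof. exact: diagC. Qed.

Lemma diagX : fps_diag (fpsX (fps R)) = fpsX R.
Proof. by rewrite -[fpsX _ in LHS]mulr1 diagXM diag1 mulr1. Qed.
End Diagonal.

Section Completions.
Local Open Scope nat_scope.

(** The number of ways to place [l] more rows above a row of width [w] with [e]
columns to its right, so as to end flush with the last column. The next row
extends [p] cells further to the right and starts [q] cells further to the
right; [q < w] makes the two rows overlap, and [p] and [q] are not both 0 since
adjacent rows differ. *)
Fixpoint completions (l e w : nat) : nat :=
  if l is l'.+1 then
    \sum_(p < e.+1) \sum_(q < w | (val p != 0) || (val q != 0))
      completions l' (e - p) (w + p - q)
  else e == 0.

(** Counting also the repeated row gives a sum over all [p] and [q]. *)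
Lemma completionsS l e w : 0 < w ->
  completions l.+1 e w + completions l e w =
    \sum_(q < w) \sum_(p < e.+1) completions l (e - p) (w - q + p).
Proof.
case: w => // w _; rewrite exchange_big /= pair_big_dep pair_bigA /=.
rewrite [RHS](bigD1 (ord0, ord0)) //= !subn0 addn0 addnC; congr (_ + _).
apply: eq_big => [[p q]|[p q] _] /=.
  by rewrite xpair_eqE -!(inj_eq val_inj) /= negb_and.
by rewrite addnBAC // ltnW.
Qed.

End Completions.

Section Rows.
Local Notation x := varX.
Local Notation y := varY.

(** Here x marks columns to the right of the current row and y marks
rows above it. *)
Definition completion_series (w : nat) : fps (fps int) :=
  Fps (fun e => Fps (fun l => (completions l e w)%:R)).

(** All the ways to widen on the right a row of width [u] and then complete it.
*)
Definition extension_series (u : nat) : fps (fps int) :=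
  Fps (fun e => \sum_(p < e.+1) fps_coef (completion_series (u + p)) (e - p)).

(** This is (1 + y) times the series of completions when [w] is positive
([width_seriesE]); the value 1 at width 0 is the one that makes the recurrence
[width_series_rec] hold from width 1 on. *)
Definition width_series (w : nat) : fps (fps int) :=
  1 + y * \sum_(u < w) extension_series u.+1.

(* The identities hold in any commutative ring: the concrete series are
   generalized first, so that they are not unfolded. *)
Ltac series_ring := repeat match goal with
  | |- context [width_series ?w] => generalize (width_series w) => ?
  | |- context [extension_series ?w] => generalize (extension_series w) => ?
  end;
  generalize varX varY; clear; move=> *; ring.

Lemma extension_series_rec u :
  extension_series u = completion_series u + x * extension_series u.+1.
Proof.
apply: fpsP => e; rewrite fps_coefD fps_coefXM.
case: e => [|e]; rewrite [LHS]/= big_ord_recl ?big_ord0 ?addr0 addn0 subn0 //.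
by congr (_ + _); apply: eq_bigr => i _; rewrite addSnnS.
Qed.

Lemma width_series0 : width_series 0 = 1.
Proof. by rewrite /width_series big_ord0 mulr0 addr0. Qed.

Lemma width_seriesS w :
  width_series w.+1 = width_series w + y * extension_series w.+1.
Proof. by rewrite /width_series big_ord_recr /= mulrDr addrA. Qed.

Lemma width_seriesE w : (0 < w)%N ->
  width_series w = (1 + y) * completion_series w.
Proof.
move=> w_gt0; apply: fpsP => e; apply: fpsP => l.
rewrite mulrDl mul1r !fps_coefD !fps_coefCM fps_coef_sum !fps_coefXM.
rewrite fps_coef1; case: l => [|l].
  by rewrite !addr0 /=; case: eqP.
rewrite fps_coef_sum [fps_coef (_%:R) _](_ : _ = 0) ?add0r; last first.
  by case: (e == 0%N).
rewrite -natrD completionsS // natr_sum.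
rewrite (reindex_inj rev_ord_inj) /=; apply: eq_bigr => q _.
rewrite natr_sum fps_coef_sum; apply: eq_bigr => p _ /=.
by rewrite subnSK.
Qed.

Lemma width_series_rec w : (0 < w)%N ->
  width_series w =
    (1 + y) * (width_series w.-1 + x * width_series w.+1 - x * width_series w).
Proof.
case: w => // w _; rewrite [width_series w.+2]width_seriesS [(w.+1).-1]/=.
have:= width_seriesE (ltn0Sn w); rewrite [completion_series _](_ : _ =
  extension_series w.+1 - x * extension_series w.+2).
  rewrite width_seriesS => E; apply/eqP; rewrite -subr_eq0; apply/eqP.
  transitivity (y *
    ((1 + y) * (extension_series w.+1 - x * extension_series w.+2)
      - (width_series w + y * extension_series w.+1))); first by series_ring.
  by rewrite E subrr mulr0.
by rewrite [extension_series w.+1]extension_series_rec addrK.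
Qed.

(** The factor x lets the coefficient of x^n in [W w] depend only on
coefficients of lower order and on the coefficient of x^n in [W w.-1]. *)
Lemma rec_uniq (W : nat -> fps (fps int)) : W 0%N = 0 ->
  (forall w, (0 < w)%N -> W w = (1 + y) * (W w.-1 + x * W w.+1 - x * W w)) ->
  forall w, W w = 0.
Proof.
move=> W0 Wrec w; apply: fpsP => n; elim: n w => [|n IHn];
  elim=> [|w IHw]; rewrite ?W0 // Wrec //.
all: rewrite (_ : 1 + y = fpsC (1 + fpsX int)) ?fps_coefCM.
all: rewrite ?fps_coefB ?fps_coefD ?fps_coefXM.
all: rewrite ?IHn ?IHw ?subr0 ?addr0 ?mulr0 //.
all: by apply: fpsP => -[|i]; rewrite fps_coefD ?addr0.
Qed.

(** The recurrence is linear, so [z * Z w - Z w.+1] satisfies it whenever [Z]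
does. *)
Lemma rec_combine (R : comNzRingType) (x y z a b c d : R) :
    a = (1 + y) * (b + x * c - x * a) -> c = (1 + y) * (a + x * d - x * c) ->
  z * a - c = (1 + y) * (z * b - a + x * (z * c - d) - x * (z * a - c)).
Proof.
move=> E1 E2; transitivity (z * ((1 + y) * (b + x * c - x * a))
                            - (1 + y) * (a + x * d - x * c)); last by ring.
by rewrite -E1 -E2.
Qed.

(** With [z := Z 1], the sequence [z * Z w - Z w.+1] satisfies the recurrence
and vanishes at 0, hence it vanishes at 1. *)
Lemma rec_square (Z : nat -> fps (fps int)) : Z 0%N = 1 ->
  (forall w, (0 < w)%N -> Z w = (1 + y) * (Z w.-1 + x * Z w.+1 - x * Z w)) ->
  Z 2%N = Z 1%N ^+ 2.
Proof.
move=> Z0 Zrec; apply/esym/eqP; rewrite -subr_eq0 expr2; apply/eqP.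
apply: (@rec_uniq (fun w => Z 1%N * Z w - Z w.+1) _ _ 1%N) => [|w w_gt0].
  by rewrite Z0 mulr1 subrr.
rewrite (prednK w_gt0); exact: rec_combine (Zrec _ w_gt0) (Zrec _ (ltn0Sn w)).
Qed.

Lemma width_series2 : width_series 2 = width_series 1 ^+ 2.
Proof. exact: rec_square width_series0 width_series_rec. Qed.

(** The series of the polyominoes in which adjacent rows differ, x marking
columns and y rows: the first row has some width w >= 1 and starts in the first
column. *)
Definition row_reduced : fps (fps int) := x * (width_series 1 - 1).

Lemma row_reduced_eq :
  (1 + y) * row_reduced = (x + row_reduced) * (y + (1 + y) * row_reduced).
Proof.
have Zrec := @width_series_rec 1 isT;
  rewrite width_series0 width_series2 in Zrec.
apply/eqP; rewrite -subr_eq0; apply/eqP.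
transitivity (x * (width_series 1 -
  (1 + y) * (1 + x * width_series 1 ^+ 2 - x * width_series 1))).
  by rewrite /row_reduced; series_ring.
by rewrite -Zrec subrr mulr0.
Qed.

Lemma coef_row_reduced n k : fps_coef (fps_coef row_reduced n) k =
  if k is k'.+1 then (\sum_(w < n) completions k' (n - w.+1) w.+1)%:R else 0.
Proof.
rewrite /row_reduced /width_series big_ord1 [1 + _]addrC addrK.
rewrite mulrCA fps_coefCM !fps_coefXM.
case: k => // k.
case: n => [|n]; first by rewrite big_ord0.
by rewrite natr_sum fps_coef_sum; apply: eq_bigr => w _; rewrite add1n subSS.
Qed.
End Rows.

(** * Polyominoes as sequences of rows *)

Section Codes.
Local Open Scope nat_scope.
Local Notation row n := ('I_n.+1 * 'I_n.+1)%type.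

(** A row [[b, a)] is encoded by the pair (a, b). The next row overlaps it,
is shifted weakly to the right, and differs from it. *)
Definition row_step n : rel (row n) := fun r r' =>
  [&& r.1 <= r'.1, r.2 <= r'.2, r'.2 < r.1 & r != r'].

Definition is_code n (c : seq (row n)) : bool :=
  if c is r :: c' then
    [&& r.2 == 0 :> nat, 0 < r.1, path (@row_step n) r c'
      & (last r c').1 == n :> nat]
  else false.

(** The boundary between columns [i - 1] and [i] separates two distinct columns
exactly when some row ends or starts there. *)
Definition hit n (c : seq (row n)) (i : nat) : bool :=
  has (fun r : row n => (r.1 == i :> nat) || (r.2 == i :> nat)) c.

(** The polyominoes with [n] columns and [k] distinct adjacent rows in which the
first [q] interior boundaries separate distinct columns. *)
Definition codes n q k : {set k.-tuple (row n)} :=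
  [set c : k.-tuple (row n) | is_code c && all (hit c) (iota 1 q)].

Lemma card_tupleS (T : finType) l (P : pred (seq T)) :
  #|[set t : l.+1.-tuple T | P t]| = \sum_x #|[set t : l.-tuple T | P (x :: t)]|.
Proof.
pose f (p : T * l.-tuple T) : l.+1.-tuple T := [tuple of p.1 :: p.2].
pose g (t : l.+1.-tuple T) : T * l.-tuple T := (thead t, [tuple of behead t]).
have fK : cancel f g.
  by case=> x t; congr (_, _); apply: val_inj.
have gK : cancel g f by move=> t; rewrite /f /= -tuple_eta.
rewrite -sum1dep_card (reindex f) /=; last by exists g => t _;
    [apply: fK|apply: gK].
under [RHS]eq_bigr do rewrite -sum1dep_card.
by rewrite pair_big_dep.
Qed.

Lemma sum_ord_shift (F : nat -> nat) (Q : pred nat) a b N : b <= N ->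
  \sum_(i < N | Q i && (a <= i < b)) F i = \sum_(p < b - a | Q (a + p)) F (a + p).
Proof.
move=> le_bN; rewrite -(big_mkord (fun p => Q (a + p)) (fun p => F (a + p))).
transitivity (\sum_(a <= i < b | Q i) F i).
  rewrite (big_nat_widenl _ 0) // big_mkord.
  rewrite (big_ord_widen_cond _ (fun i => Q i && (a <= i)) F le_bN).
  by apply: eq_bigl => i; rewrite andbA.
rewrite -{1}[a]add0n big_addn.
by apply: eq_big => i; rewrite addnC.
Qed.

Lemma card_paths n l (r : row n) : r.2 < r.1 ->
  #|[set c : l.-tuple (row n) | path (@row_step n) r c
                                & (last r c).1 == n :> nat]|
  = completions l (n - r.1) (r.1 - r.2).
Proof.
elim: l r => [|l IHl] r lt_r.
  rewrite [RHS]/= subn_eq0.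
  have -> : (n <= r.1) = (r.1 == n :> nat) by have := ltn_ord r.1; lia.
  case: eqP => E.
    rewrite (_ : [set _ | _] = setT) ?cardsT ?card_tuple //.
    by apply/setP => c; rewrite !inE tuple0 /= E eqxx.
  apply: eq_card0 => c; rewrite !inE tuple0 /=; exact/eqP.
rewrite (card_tupleS _ (fun c =>
  path (@row_step n) r c && ((last r c).1 == n :> nat))).
transitivity (\sum_(r' | row_step r r') completions l (n - r'.1) (r'.1 - r'.2)).
  rewrite [RHS]big_mkcond /=; apply: eq_bigr => r' _; case: ifP => st.
    by rewrite -IHl //; case/and4P: st => *; lia.
  by apply: eq_card0 => c; rewrite !inE.
case: r lt_r {IHl} => a b /= lt_ba.
rewrite -(pair_big_dep predT (fun a' b' => row_step (a, b) (a', b'))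
  (fun a' b' : 'I_n.+1 => completions l (n - a') (a' - b'))) /=.
transitivity (\sum_(a' < n.+1 | true && (a <= a' < n.+1))
    \sum_(b' < n.+1 | ((a' != a :> nat) || (b' != b :> nat)) && (b <= b' < a))
        completions l (n - a') (a' - b')).
  rewrite [RHS]big_mkcond /=; apply: eq_bigr => a' _; case: ifP => le_aa'.
    apply: eq_bigl => b'; rewrite /row_step /= xpair_eqE -!val_eqE /=.
    case/andP: le_aa' => -> _;
      rewrite negb_and (eq_sym (val a)) (eq_sym (val b)) /=.
    by case: (b' < a); case: (b <= b'); rewrite /= ?andbT ?andbF.
  rewrite big_pred0 // => b'; rewrite /row_step.
  have {le_aa'} : (a <= a') = false by rewrite -le_aa' ltn_ord andbT.
  by move=> /= ->.
rewrite (sum_ord_shift (fun a' =>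
  \sum_(b' < n.+1 | ((a' != a :> nat) || (b' != b :> nat)) && (b <= b' < a))
        completions l (n - a') (a' - b')) predT) //.
rewrite subSn; last by rewrite -ltnS.
apply: eq_bigr => p _.
rewrite (sum_ord_shift (fun b' => completions l (n - (a + p)) (a + p - b'))
  (fun b' => (a + p != a) || (b' != b))) //; last exact: ltnW.
apply: eq_big => q; first by lia.
by move=> _; congr completions; lia.
Qed.

Lemma card_codes0 n k : #|codes n 0 k| =
  if k is k'.+1 then \sum_(w < n) completions k' (n - w.+1) w.+1 else 0.
Proof.
have -> : #|codes n 0 k| = #|[set c : k.-tuple (row n) | is_code c]|.
  by apply: eq_card => c; rewrite !inE andbT.
case: k => [|k]; first by apply: eq_card0 => c; rewrite !inE tuple0.
rewrite card_tupleS; transitivity (\sum_(a < n.+1) \sum_(b < n.+1)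
    #|[set t : k.-tuple (row n) | is_code ((a, b) :: t)]|).
  by rewrite pair_bigA; apply: eq_bigr => -[a b].
rewrite big_ord_recl [X in X + _]big1 ?add0n => [|b _]; last first.
  by apply: eq_card0 => c; rewrite !inE /= andbF.
apply: eq_bigr => w _; rewrite big_ord_recl [X in _ + X]big1 ?addn0 => [|b _];
  last first.
  by apply: eq_card0 => c; rewrite !inE.
have <- := @card_paths n k (lift ord0 w, ord0) isT.
by apply: eq_card => c; rewrite !inE.
Qed.

Section Lift.
Variables (n : nat) (h : 'I_n.+2).

Definition lift_row (r : row n) : row n.+1 := (lift h r.1, lift h r.2).

Lemma lift_row_inj : injective lift_row.
Proof.
case=> a b [a' b'] /eqP; rewrite xpair_eqE.
by case/andP=> /eqP/lift_inj /= -> /eqP/lift_inj /= ->.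
Qed.

Lemma row_step_lift r r' : row_step (lift_row r) (lift_row r') = row_step r r'.
Proof.
by rewrite /row_step /= !leq_bump2 (inj_eq lift_row_inj) !ltnNge leq_bump2.
Qed.

Lemma is_code_lift c : 0 < h <= n -> is_code (map lift_row c) = is_code c.
Proof.
case: c => [|r c] //= /andP[h_gt0 le_hn]; rewrite path_map last_map /=.
rewrite (eq_path row_step_lift) /bump; congr [&& _, _, _ & _]; lia.
Qed.

Lemma hit_lift c i : i < h -> hit (map lift_row c) i = hit c i.
Proof.
by move=> lt_ih; rewrite /hit has_map; apply: eq_has => r /=; rewrite /bump;
  lia.
Qed.

Lemma hit_liftF c : hit (map lift_row c) h = false.
Proof. by rewrite /hit has_map; apply/hasPn => r _ /=; rewrite /bump; lia. Qed.

Lemma lift_unhit (c : seq (row n.+1)) : ~~ hit c h ->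
  exists c', c = map lift_row c'.
Proof.
elim: c => [|[a b] c IHc]; first by exists [::].
rewrite /hit /= negb_or => /andP[/norP[neq_a neq_b] /IHc[c' ->]].
have /unlift_some[a' -> _] : h != a by rewrite eq_sym.
have /unlift_some[b' -> _] : h != b by rewrite eq_sym.
by exists ((a', b') :: c').
Qed.
End Lift.

(** If the boundary [q.+1] is not hit, the columns on its two sides are equal;
deleting one of them renumbers the boundaries by [unlift]. *)
Lemma card_codesS n q k : q < n ->
  #|codes n.+1 q.+1 k| + #|codes n q k| = #|codes n.+1 q k|.
Proof.
move=> lt_qn; pose h : 'I_n.+2 := inord q.+1.
have hE : h = q.+1 :> nat by rewrite inordK //; lia.
pose H := [set c : k.-tuple (row n.+1) | hit c h].
rewrite -(cardsID H (codes n.+1 q k)); congr (_ + _).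
  apply: eq_card => c;
    rewrite !inE hE -[in iota 1 q.+1](addn1 q) iotaD all_cat /=.
  by rewrite andbT add1n andbA.
rewrite -(card_imset _ (f := fun c : k.-tuple (row n) =>
    [tuple of map (lift_row h) c])).
  apply: eq_card => c; apply/imsetP/setDP => [[c' + ->]|[]].
    rewrite !inE /= hit_liftF is_code_lift ?hE //.
    move=> /andP[-> /allP Hq]; split=> //; apply/allP => i iq.
    by rewrite hit_lift ?Hq // hE; move: iq; rewrite mem_iota; lia.
  rewrite !inE => /andP[cc /allP Hq] /lift_unhit[c' cE].
  have sz : size c' == k by rewrite -(size_tuple c) cE size_map.
  exists (Tuple sz); last exact: val_inj.
  rewrite inE /= -(@is_code_lift _ h) -?cE ?hE //.
  rewrite cc; apply/allP => i iq.
  by rewrite -(@hit_lift _ h) -?cE ?Hq // hE; move: iq; rewrite mem_iota; lia.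
move=> c c' [/(inj_map (@lift_row_inj _ h)) E]; exact: val_inj.
Qed.
End Codes.

(** * Permutations as pairs of shuffles *)

Section RelCard.
(** A total relation that is injective on [A] contains the graph of an
injection. *)
Lemma leq_card_rel (S T : finType) (A : {set S}) (B : {set T})
    (r : S -> T -> Prop) :
    (forall x, x \in A -> exists2 y, y \in B & r x y) ->
    (forall x x' y, x \in A -> x' \in A -> y \in B ->
      r x y -> r x' y -> x = x') ->
  (#|A| <= #|B|)%N.
Proof.
move=> r_ex r_inj; pose f x := [pick y | (y \in B) && `[< r x y >]].
have fP x : x \in A -> exists2 y, y \in B & f x = Some y /\ r x y.
  move=> xA; rewrite /f; case: pickP => [y /andP[yB /asboolP rxy]|none].
    by exists y.
  have [y yB rxy] := r_ex x xA.
  by have := none y; rewrite yB /=; move/asboolP.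
rewrite -(card_in_imset (f := f) (D := A)) => [|x x' xA x'A].
  have SomeI : injective (@Some T) by move=> y y' [].
  rewrite -(card_imset B SomeI); apply: subset_leq_card.
  by apply/subsetP=> _ /imsetP[x /fP[y yB [-> _]] ->]; apply: imset_f.
have [y yB [-> rxy]] := fP x xA; have [y' _ [-> rxy']] := fP x' x'A.
by case=> Ey; apply: (r_inj x x' y); rewrite // Ey.
Qed.
End RelCard.

Section Blocks.
Local Open Scope nat_scope.

(** A set with no element between two of its own, in position or in value, is an
interval of positions whose image is an interval: its extreme elements bound
both intervals. *)
Lemma abs_irreducibleP m (s : 'S_m) :
  absolutely_irreducible s <->
  forall Z : {set 'I_m},
    (forall x y z, y \notin Z -> x \in Z -> z \in Z ->
       ~~ (x < y < z) /\ ~~ (s x < s y < s z)) ->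
    forall x y, x \in Z -> y \in Z -> x != y -> forall z, z \in Z.
Proof.
split=> [irr Z Zconv x y xZ yZ neq_xy z | irr].
  apply/negPn/negP => zZ.
  pose i := [arg min_(i < x in Z) (i : nat)].
  pose j := [arg max_(i > x in Z) (i : nat)].
  pose c := [arg min_(i < x in Z) (s i : nat)].
  pose d := [arg max_(i > x in Z) (s i : nat)].
  have [iZ imin] : i \in Z /\ forall t, t \in Z -> i <= t.
    by rewrite /i; case: arg_minnP.
  have [jZ jmax] : j \in Z /\ forall t, t \in Z -> t <= j.
    by rewrite /j; case: arg_maxnP.
  have [cZ cmin] : c \in Z /\ forall t, t \in Z -> s c <= s t.
    by rewrite /c; case: arg_minnP.
  have [dZ dmax] : d \in Z /\ forall t, t \in Z -> s t <= s d.
    by rewrite /d; case: arg_maxnP.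
  have Zpos t : (t \in Z) = (i <= t <= j).
    apply/idP/idP => [tZ|]; first by rewrite imin ?jmax.
    move=> /andP[le_it le_tj]; apply/negPn/negP => tZ.
    have [/negP nbtw _] := Zconv i t j tZ iZ jZ; apply: nbtw.
    rewrite !ltn_neqAle le_it le_tj !andbT; apply/andP; split.
      by apply: contraNneq tZ => /val_inj <-.
    by apply: contraNneq tZ => /val_inj ->.
  have Zval t : (t \in Z) = (s c <= s t <= s d).
    apply/idP/idP => [tZ|]; first by rewrite cmin ?dmax.
    move=> /andP[le_it le_tj]; apply/negPn/negP => tZ.
    have [_ /negP nbtw] := Zconv c t d tZ cZ dZ; apply: nbtw.
    rewrite !ltn_neqAle le_it le_tj !andbT; apply/andP; split.
      by apply: contraNneq tZ => /val_inj/perm_inj <-.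
    by apply: contraNneq tZ => /val_inj/perm_inj ->.
  move/negP: irr; apply; apply/existsP; exists i; apply/existsP; exists j.
  apply/and3P; split.
  - move: neq_xy (imin x xZ) (imin y yZ) (jmax x xZ) (jmax y yZ).
    rewrite -val_eqE /=; lia.
  - rewrite properT; apply: contraNneq zZ => ZT.
    have: z \in segment i j by rewrite ZT inE.
    by rewrite inE Zpos.
  - apply/existsP; exists (s c); apply/existsP; exists (s d).
    apply/eqP/setP => t; rewrite -(permKV s t) mem_imset; last exact: perm_inj.
    by rewrite !inE -Zpos -Zval.
apply/negP => /existsP[i /existsP[j /and3P[lt_ij prop]]].
case/existsP=> c /existsP[d /eqP segE].
have Zval t : (t \in segment i j) = (c <= s t <= d).
  by rewrite -(mem_imset _ _ (@perm_inj _ s)) segE inE.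
move: prop; rewrite properE subsetT /=; case/subsetPn => z _ /negP[].
apply: (irr (segment i j) _ i j); rewrite ?inE ?leqnn ?(ltnW lt_ij) //.
  move=> x y t yZ xZ tZ; split; first by move: xZ tZ yZ; rewrite !inE; lia.
  by move: xZ tZ yZ; rewrite !Zval; lia.
by rewrite -val_eqE /= neq_ltn lt_ij.
Qed.
End Blocks.

Section Merge.
Local Open Scope nat_scope.
Variables n k : nat.
Local Notation T := ('I_n + 'I_k)%type.

(** The maxima are the [inl i] and the other entries the [inr j]. The function
[a] says how to shuffle the two lists: [a j] of the [inl i] come before [inr
j]. One shuffle gives the order of the positions and another that of the
values. *)
Definition before (a : 'I_k -> nat) (u v : T) : bool :=
  match u, v with
  | inl i, inl i' => i < i'
  | inr j, inr j' => j < j'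
  | inl i, inr j => i < a j
  | inr j, inl i => a j <= i
  end.

Definition order_iso a (pos : T -> 'I_(n + k)) :=
  forall u v, before a u v = (pos u < pos v).

Lemma before_total a u v : u != v -> before a u v || before a v u.
Proof.
case: u v => [i|j] [i'|j'] /=; last 1 first.
- by rewrite (inj_eq inr_inj) -val_eqE /= neq_ltn.
- by rewrite (inj_eq inl_inj) -val_eqE /= neq_ltn.
- by rewrite ltnNge orNb.
- by rewrite leqNgt orNb.
Qed.

Lemma order_iso_inj a pos : order_iso a pos -> injective pos.
Proof.
move=> iso u v Euv; apply/eqP; apply: contraT => /(before_total a).
by rewrite !iso Euv ltnn.
Qed.

Lemma order_iso_bij a pos : order_iso a pos -> bijective pos.
Proof.
move/order_iso_inj/inj_card_bij; apply.
by rewrite card_sum !card_ord.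
Qed.

(** The position of an entry is the number of entries before it, so the shuffle
determines [pos]. *)
Lemma order_iso_rank a pos u :
  order_iso a pos -> val (pos u) = #|[set w | before a w u]|.
Proof.
move=> iso; have [g posK gK] := order_iso_bij iso.
rewrite -(card_imset _ (order_iso_inj iso)).
transitivity #|[set z : 'I_(n + k) | z < pos u]|.
  rewrite -sum1dep_card -(big_ord_widen _ (fun=> 1)) ?sum1_card ?card_ord //.
  exact/ltnW/ltn_ord.
apply: eq_card => z; rewrite !inE -[z]gK mem_imset ?inE ?iso //.
exact: order_iso_inj iso.
Qed.

Lemma order_iso_uniq a pos pos' :
  order_iso a pos -> order_iso a pos' -> pos =1 pos'.
Proof.
by move=> iso iso' u; apply: val_inj;
  rewrite (order_iso_rank u iso) (order_iso_rank u iso').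
Qed.

Lemma order_iso_ex a : (forall j j' : 'I_k, j <= j' -> a j <= a j') ->
  exists pos, order_iso a pos.
Proof.
move=> a_mono.
have irr u : before a u u = false by case: u => i /=; rewrite ltnn.
have tr u v w : before a u v -> before a v w -> before a u w.
  case: u v w => [u|u] [v|v] [w|w] //=; try lia.
  - by move=> lt1 /ltnW/a_mono; lia.
  - move=> le1 lt2; rewrite ltnNge; apply/negP => /a_mono; lia.
  - by move=> /ltnW/a_mono; lia.
pose rk u := #|[set w | before a w u]|.
have rk_lt u : rk u < n + k.
  have -> : n + k = #|[set: T]| by rewrite cardsT card_sum !card_ord.
  apply: proper_card; rewrite properT; apply/eqP => /setP/(_ u).
  by rewrite !inE irr.
have rk_mono u v : before a u v -> rk u < rk v.
  move=> lt_uv; apply: proper_card; apply/properP; split.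
    by apply/subsetP => w; rewrite !inE => /tr; apply.
  by exists u; rewrite !inE ?irr.
exists (fun u => Ordinal (rk_lt u)) => u v /=.
apply/idP/idP => [/rk_mono //|lt_uv]; apply: contraTT lt_uv => not_uv.
rewrite -leqNgt; have [->//|] := eqVneq u v.
by move/(before_total a); rewrite (negbTE not_uv) => /rk_mono/ltnW.
Qed.

Lemma order_iso_mono a pos : order_iso a pos -> (forall j, a j <= n) ->
  forall j j' : 'I_k, j <= j' -> a j <= a j'.
Proof.
move=> iso a_le j j' le_jj'; rewrite leqNgt; apply/negP => lt_a.
pose i := Ordinal (leq_trans lt_a (a_le j)).
have: before a (inl i) (inr j) by [].
have: ~~ before a (inl i) (inr j') by rewrite /= ltnn.
rewrite !iso -leqNgt => le1 lt1.
have := leq_ltn_trans le1 lt1; rewrite -iso /=; lia.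
Qed.

Lemma down_card (D : {set 'I_n}) :
  (forall i i' : 'I_n, i < i' -> i' \in D -> i \in D) ->
  forall i : 'I_n, (i < #|D|) = (i \in D).
Proof.
move=> down i; have card_lt (p : 'I_n) : #|[set i : 'I_n | i < p]| = p.
  rewrite -sum1dep_card -(big_ord_widen _ (fun=> 1)) ?sum1_card ?card_ord //.
  exact/ltnW/ltn_ord.
apply/idP/idP => [|iD].
  apply: contraTT => iD; rewrite -leqNgt -(card_lt i); apply: subset_leq_card.
  apply/subsetP => p pD; rewrite inE ltnNge; apply: contra iD.
  by rewrite leq_eqVlt => /predU1P[/val_inj->|/down->].
rewrite -{1}(card_lt i) (cardsD1 i D) iD add1n ltnS; apply: subset_leq_card.
apply/subsetP => p; rewrite !inE => lt_pi; rewrite (down p i) // andbT.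
by rewrite -val_eqE /= neq_ltn lt_pi.
Qed.

Lemma order_iso_of_mono (pos : T -> 'I_(n + k)) : injective pos ->
    (forall i i' : 'I_n, i < i' -> pos (inl i) < pos (inl i')) ->
    (forall j j' : 'I_k, j < j' -> pos (inr j) < pos (inr j')) ->
  exists2 a : 'I_k -> nat, order_iso a pos & forall j, a j <= n.
Proof.
move=> inj mono_l mono_r.
pose a j := #|[set i : 'I_n | pos (inl i) < pos (inr j)]|.
have aE (i : 'I_n) j : (i < a j) = (pos (inl i) < pos (inr j)).
  rewrite down_card ?inE // => p p' /mono_l lt_p; rewrite !inE.
  exact: ltn_trans.
have nat_neq u v : u != v -> pos u != pos v :> nat.
  by move=> neq; rewrite val_eqE (inj_eq inj).
exists a => [[i|j] [i'|j'] /=|j].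
- apply/idP/idP => [/mono_l//|]; apply: contraTT; rewrite -!leqNgt.
  by rewrite leq_eqVlt => /predU1P[/val_inj->|/mono_l/ltnW].
- exact: aE.
- by rewrite leqNgt aE -leqNgt leq_eqVlt (negbTE (nat_neq _ _ _)).
- apply/idP/idP => [/mono_r//|]; apply: contraTT; rewrite -!leqNgt.
  by rewrite leq_eqVlt => /predU1P[/val_inj->|/mono_r/ltnW].
- by rewrite -[leqRHS]card_ord; apply: max_card.
Qed.
End Merge.

(** * Irreducibility as reducedness of the polyomino *)

Section Polyomino.
Local Open Scope nat_scope.
Variables n k : nat.
Local Notation T := ('I_n + 'I_k)%type.
Variables a b : 'I_k -> nat.
Hypothesis a_le : forall j, a j <= n.

(** The entries of a contiguous subword whose values form an interval. *)
Definition block (X : {set T}) : Prop :=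
  forall u v w, v \notin X -> u \in X -> w \in X ->
    ~~ (before a u v && before a v w) /\ ~~ (before b u v && before b v w).

Definition blockless : Prop := forall X, block X ->
  forall u v, u \in X -> v \in X -> u != v -> forall w, w \in X.

(** Rows [[b j, a j)] of a parallelogram polyomino with [n] columns in which
adjacent rows differ and adjacent columns differ. Taking [j = i] in
[rp_overlap] says that rows are nonempty. *)
Record reduced_polyomino : Prop := ReducedPolyomino {
  rp_mono : forall j j' : 'I_k, j <= j' -> a j <= a j' /\ b j <= b j';
  rp_overlap : forall i j : 'I_k, j <= i.+1 -> b j < a i;
  rp_first : forall j : 'I_k, j = 0 :> nat -> b j = 0;
  rp_last : forall j : 'I_k, j.+1 = k -> a j = n;
  rp_rows : forall i j : 'I_k, j = i.+1 :> nat -> ~ (a i = a j /\ b i = b j);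
  rp_cols : forall i, 0 < i < n -> exists j, a j = i \/ b j = i
}.

(** Each failing condition exhibits a block: a prefix in both orders when two
consecutive rows do not overlap, everything but the first or the last maximum
when the figure does not reach its first or last column, and two equal adjacent
rows or columns otherwise. *)
Lemma blockless_polyomino : 0 < k ->
  (forall j j' : 'I_k, j <= j' -> a j <= a j') ->
  (forall j j' : 'I_k, j <= j' -> b j <= b j') ->
  (forall j, b j < a j) -> blockless -> reduced_polyomino.
Proof.
move=> k_gt0 a_mono b_mono diag nb.
have pivot (j : 'I_k) : exists2 i : 'I_n, i = b j :> nat & i < a j.
  by exists (Ordinal (leq_trans (diag j) (a_le j))) => //=.
have overlap : forall i j : 'I_k, j <= i.+1 -> b j < a i.
  move=> i j; rewrite leq_eqVlt => /predU1P[ji|]; last first.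
    by rewrite ltnS => /b_mono le_b; apply: leq_ltn_trans le_b (diag i).
  rewrite ltnNge; apply/negP => le_ab.
  pose X : {set T} :=
    [set u : T | match u with inl p => p < a i | inr q => q <= i end].
  have [p Ep lt_p] := pivot i.
  suff: inr j \in X by rewrite inE ji ltnn.
  apply: (nb X _ (inl p) (inr i)); rewrite ?inE // => u v w.
  rewrite !inE => vX _ wX; case: v w vX wX => [v|v] [w|w] /= vX wX; try lia.
  - have := a_mono _ _ wX; have := b_mono _ _ wX; have := diag i; lia.
  - have le_jv : j <= v by lia.
    have le_iv : i <= v by lia.
    have := a_mono _ _ le_iv; have := b_mono _ _ le_jv; lia.
split=> //.
- by move=> j j' le_j; split; [apply: a_mono|apply: b_mono].
- move=> j j0; apply/eqP; rewrite -leqn0 leqNgt; apply/negP => b_gt0.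
  have [p Ep lt_p] := pivot j.
  have n_gt0 : 0 < n by apply: leq_ltn_trans (ltn_ord p).
  pose o : 'I_n := Ordinal n_gt0.
  suff: inl o \in [set~ (inl o : T)] by rewrite !inE eqxx.
  apply: (nb [set~ inl o] _ (inl p) (inr j)); rewrite ?inE //.
    move=> u v w; rewrite !inE negbK => /eqP -> _ _.
    case: u => [u|u] /=; first by [].
    have le_ju : j <= u by rewrite j0.
    by have := a_mono _ _ le_ju; have := b_mono _ _ le_ju; have := diag j; lia.
  by rewrite (inj_eq inl_inj) -val_eqE /= Ep -lt0n.
- move=> j jk; apply/eqP; rewrite eqn_leq a_le leqNgt; apply/negP => lt_a.
  have [p Ep lt_p] := pivot j.
  have lt_n : n.-1 < n by lia.
  pose o : 'I_n := Ordinal lt_n.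
  suff: inl o \in [set~ (inl o : T)] by rewrite !inE eqxx.
  apply: (nb [set~ inl o] _ (inl p) (inr j)); rewrite ?inE //.
    move=> u v w; rewrite !inE negbK => /eqP -> _ _.
    case: w => [w|w] /=; first by have := ltn_ord w; lia.
    have le_wj : w <= j by have := ltn_ord w; lia.
    by have := a_mono _ _ le_wj; have := b_mono _ _ le_wj; have := diag j; lia.
  by rewrite (inj_eq inl_inj) -val_eqE /=; lia.
- move=> i j ji [Ea Eb]; have [p Ep lt_p] := pivot i.
  suff: inl p \in [set (inr i : T); inr j] by rewrite !inE.
  apply: (nb [set inr i; inr j] _ (inr i) (inr j)); rewrite ?inE ?eqxx ?orbT //.
    move=> u v w; rewrite !inE => vX.
    case: v vX => [v|v] vX /orP[]/eqP-> /orP[]/eqP-> /=; lia.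
  by rewrite (inj_eq inr_inj) -val_eqE /=; lia.
- move=> i /andP[i_gt0 lt_in].
  have [[j]|none] := pselect (exists j, a j = i \/ b j = i); first by exists j.
  have none_a j : a j <> i by move=> E; apply: none; exists j; left.
  have none_b j : b j <> i by move=> E; apply: none; exists j; right.
  have lt_i1 : i.-1 < n by lia.
  pose o : 'I_n := Ordinal lt_i1; pose o' : 'I_n := Ordinal lt_in.
  suff: inr (Ordinal k_gt0) \in [set (inl o : T); inl o'] by rewrite !inE.
  apply: (nb [set inl o; inl o'] _ (inl o) (inl o'));
    rewrite ?inE ?eqxx ?orbT //.
    move=> u v w; rewrite !inE => vX.
    case: v vX => [v|v] vX /orP[]/eqP-> /orP[]/eqP-> /=;
      try lia; by have := none_a v; have := none_b v; lia.
  by rewrite (inj_eq inl_inj) -val_eqE /=; lia.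
Qed.

(** A block with two entries contains a row and a column, because equal types
are separated by the other type, and then an inversion (p, q). An entry outside
the block is below and before all of it or above and after all of it, since
otherwise it would form a 321 with that inversion. The entries on one side
would then be cut off from the rest, against the overlap of consecutive rows
and the fact that the figure reaches its first and last columns. *)
Lemma polyomino_blockless : 0 < k -> reduced_polyomino -> blockless.
Proof.
move=> k_gt0 [mono overlap first_ last_ rows_ cols_] X bX.
have diag j : b j < a j by apply: overlap.
(* Two columns in a block are separated by the end of some row, which lies
   between them; likewise for two rows. So a block has a column and a row. *)
have ll (p p' : 'I_n) : inl p \in X -> inl p' \in X -> p < p' ->
    exists q, inr q \in X.
  move=> pX p'X lt_p; have lt_n := ltn_ord p'.
  have [|j Ej] := cols_ p.+1; first by lia.
  exists j; apply/negPn/negP => jX; have [] := bX _ _ _ jX pX p'X.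
  by case: Ej => Ej /=; rewrite Ej ltnSn lt_p.
have rr (q q' : 'I_k) : inr q \in X -> inr q' \in X -> q < q' ->
    exists p, inl p \in X.
  move=> qX q'X lt_q; have lt_k := ltn_ord q'.
  have lt_q1 : q.+1 < k by lia.
  have [le_a le_b] := mono q (Ordinal lt_q1) (leqnSn q).
  have [le_a' le_b'] := mono (Ordinal lt_q1) q' lt_q.
  have [lt_a|ge_a] := ltnP (a q) (a (Ordinal lt_q1)).
    have lt_an : a q < n by apply: leq_trans lt_a (a_le _).
    exists (Ordinal lt_an); apply/negPn/negP => jX.
    by have [/negP[]] := bX _ _ _ jX qX q'X; rewrite /= leqnn; lia.
  have [lt_b|ge_b] := ltnP (b q) (b (Ordinal lt_q1)).
    have lt_bn : b q < n by apply: leq_trans (diag q) (a_le _).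
    exists (Ordinal lt_bn); apply/negPn/negP => jX.
    by have [_ /negP[]] := bX _ _ _ jX qX q'X; rewrite /= leqnn; lia.
  by case: (rows_ q (Ordinal lt_q1)) => //; split; lia.
move=> u v uX vX neq_uv.
have [[p pX] [q qX]] : (exists p, inl p \in X) /\ (exists q, inr q \in X).
  case: u v uX vX neq_uv => [u|u] [v|v] uX vX neq_uv.
  - split; first by exists u.
    have: u != v :> nat by rewrite val_eqE -(inj_eq (@inl_inj _ 'I_k)).
    by rewrite neq_ltn => /orP[]; apply: ll.
  - by split; [exists u|exists v].
  - by split; [exists v|exists u].
  - split; last by exists u.
    have: u != v :> nat by rewrite val_eqE -(inj_eq (@inr_inj 'I_n _)).
    by rewrite neq_ltn => /orP[]; apply: rr.
(* If row q does not meet column p, the last or first column of row q lies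
   between the two. *)
have {p pX} [p pX /andP[le_bp lt_pa]] :
    exists2 p : 'I_n, inl p \in X & b q <= p < a q.
  have [lt_pb|le_bp] := ltnP p (b q).
    have lt_n : (a q).-1 < n by have := diag q; have := a_le q; lia.
    exists (Ordinal lt_n); last by have := diag q; rewrite /=; lia.
    apply/negPn/negP => p'X.
    by have [/negP[]] := bX _ _ _ p'X pX qX; rewrite /=; have := diag q; lia.
  have [lt_pa|le_ap] := ltnP p (a q); first by exists p; rewrite ?le_bp.
  have lt_n : b q < n by apply: leq_trans (diag q) (a_le q).
  exists (Ordinal lt_n); last by rewrite /= leqnn diag.
  apply/negPn/negP => p'X.
  by have [_ /negP[]] := bX _ _ _ p'X qX pX; rewrite /=; have := diag q; lia.
(* Everything outside the block is entirely below and before it or entirely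
   above and after it; comparing with p or q of the same type tells which. *)
move=> w; apply/negPn/negP => wX.
pose low (z : T) := match z with inl i => i < p | inr j => j < q end.
have flip c z x : z \notin X -> x \in X -> ~~ before c x z -> before c z x.
  move=> zX xX; have: z != x by apply: contraNneq zX => ->.
  by move/(before_total c)/orP => [->|->].
have lowP z x : z \notin X -> low z -> x \in X -> before a z x && before b z x.
  move=> zX lz xX.
  have [w0 w0X [wa wb]] : exists2 w0, w0 \in X & before a z w0 /\ before b z w0.
    by case: z zX lz => i _ lz; [exists (inl p)|exists (inr q)].
  have := bX _ _ _ zX xX w0X; rewrite wa wb !andbT => -[na nb].
  by apply/andP; split; apply: flip.
have highP z x : z \notin X -> ~~ low z -> x \in X ->
  before a x z && before b x z.
  move=> zX hz xX.
  have [w0 w0X [wa wb]] : exists2 w0, w0 \in X & before a w0 z /\ before b w0 z.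
    case: z zX hz => i iX;
      rewrite /low -leqNgt leq_eqVlt => /orP[/eqP/val_inj E|lt_i].
    - by rewrite -E pX in iX.
    - by exists (inl p).
    - by rewrite -E qX in iX.
    - by exists (inr q).
  have := bX _ _ _ zX w0X xX; rewrite wa wb /= => -[na nb].
  have: z != x by apply: contraNneq zX => ->.
  move=> neq; have := before_total a neq; have := before_total b neq.
  by rewrite (negbTE na) (negbTE nb) /= => -> ->.
have [lw|hw] := boolP (low w).
  have [j Pj|noj] := pickP (fun j : 'I_k => (inr j \notin X) && (j < q)).
    (* the last row below the block is cut off from the next one, in the block *)
    case: (@arg_maxnP _ j (fun j => (inr j \notin X) && (j < q))
      (@nat_of_ord k) Pj) => j1 /andP[j1X lt_j1q] j1max.
    have lt_e : j1.+1 < k by apply: leq_ltn_trans (ltn_ord q).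
    pose e := Ordinal lt_e.
    have eX : inr e \in X.
      apply/negPn/negP => eX; have [lt_eq|ge_eq] := ltnP e q.
        by have := j1max e; rewrite eX lt_eq /= => /(_ isT); rewrite ltnn.
      have E : e = q by apply/val_inj/eqP; rewrite eqn_leq lt_j1q ge_eq.
      by rewrite E qX in eX.
    have lt_ba : b e < a j1 by apply: overlap.
    have lt_n : b e < n by apply: leq_trans lt_ba (a_le _).
    have [zX|zX] := boolP (inl (Ordinal lt_n) \in X).
      by have := lowP _ _ j1X lt_j1q zX; rewrite /= leqNgt lt_ba.
    have [lz|hz] := boolP (low (inl (Ordinal lt_n))).
      by have := lowP _ _ zX lz eX; rewrite /= ltnn andbF.
    by have := highP _ _ zX hz eX; rewrite /= leqNgt diag.
  case: w wX lw => [i|j] wX lw; last first.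
    by have := noj j; rewrite wX; move: lw => /= ->.
  have oX : inr (Ordinal k_gt0) \in X.
    apply/negPn/negP => oX; have [lt_q|ge_q] := ltnP 0 q.
      by have := noj (Ordinal k_gt0); rewrite oX /= lt_q.
    have E : Ordinal k_gt0 = q by apply/val_inj/esym/eqP; rewrite -leqn0.
    by rewrite E qX in oX.
  by have := lowP _ _ wX lw oX; rewrite /= [b _]first_ // andbF.
have [j Pj|noj] := pickP (fun j : 'I_k => (inr j \notin X) && (q < j)).
  (* the first row above the block is cut off from the previous one *)
  case: (@arg_minnP _ j (fun j => (inr j \notin X) && (q < j))
    (@nat_of_ord k) Pj) => j1 /andP[j1X lt_qj1] j1min.
  have lt_e : j1.-1 < k by apply: leq_ltn_trans (leq_pred _) (ltn_ord j1).
  pose e := Ordinal lt_e.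
  have eS : e.+1 = j1 by rewrite /= prednK // (leq_ltn_trans _ lt_qj1).
  have eX : inr e \in X.
    apply/negPn/negP => eX; have [lt_eq|ge_eq] := ltnP q e.
      by have := j1min e; rewrite eX lt_eq => /(_ isT); rewrite -eS ltnn.
    have E : e = q by apply/val_inj/eqP; rewrite eqn_leq ge_eq -ltnS eS.
    by rewrite E qX in eX.
  have lt_ba : b j1 < a e by apply: overlap; rewrite eS.
  have lt_n : b j1 < n by apply: leq_trans lt_ba (a_le _).
  have hj1 : ~~ low (inr j1) by rewrite /= -leqNgt ltnW.
  have [zX|zX] := boolP (inl (Ordinal lt_n) \in X).
    by have := highP _ _ j1X hj1 zX; rewrite /= ltnn andbF.
  have [lz|hz] := boolP (low (inl (Ordinal lt_n))).
    have [_ le_b] := mono e j1 (leq_pred _).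
    by have := lowP _ _ zX lz eX; rewrite /= [b j1 < b e]ltnNge le_b andbF.
  by have := highP _ _ zX hz eX; rewrite /= [a e <= _]leqNgt lt_ba.
case: w wX hw => [i|j] wX hw; last first.
  have := noj j;
    rewrite wX /= ltn_neqAle leqNgt hw andbT => /negbFE/eqP/val_inj E.
  by rewrite -E qX in wX.
have lt_k : k.-1 < k by rewrite prednK.
have oX : inr (Ordinal lt_k) \in X.
  apply/negPn/negP => oX; have [lt_q|ge_q] := ltnP q k.-1.
    by have := noj (Ordinal lt_k); rewrite oX /= lt_q.
  have E : Ordinal lt_k = q.
    by apply/val_inj/eqP; rewrite eqn_leq ge_q -ltnS prednK ?ltn_ord.
  by rewrite E qX in oX.
have := highP _ _ wX hw oX; rewrite /= [a _]last_ ?prednK //.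
by rewrite leqNgt ltn_ord.
Qed.
End Polyomino.

(** * From irreducible permutations to polyominoes and back *)

Section Increasing.
Local Open Scope nat_scope.

Lemma increasing_inj N m (f : 'I_N -> 'I_m) :
  {homo f : i j / (i < j)%N >-> (i < j)%N} -> injective f.
Proof.
move=> mono i j Eij; apply: val_inj.
by case: (ltngtP i j) => // /mono; rewrite Eij ltnn.
Qed.

Lemma increasing_lt N m (f : 'I_N -> 'I_m) :
  {homo f : i j / (i < j)%N >-> (i < j)%N} ->
  forall i j, (f i < f j) = (i < j).
Proof.
move=> mono i j; apply/idP/idP => [|/mono//]; apply: contraTT.
by rewrite -!leqNgt leq_eqVlt => /predU1P[/val_inj->|/mono/ltnW].
Qed.

(** Both enumerate the same set in increasing order. *)
Lemma increasing_uniq N m (f g : 'I_N -> 'I_m) :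
    {homo f : i j / (i < j)%N >-> (i < j)%N} ->
    {homo g : i j / (i < j)%N >-> (i < j)%N} ->
    (forall i, exists i', f i = g i') -> (forall i, exists i', g i = f i') ->
  f =1 g.
Proof.
move=> f_mono g_mono fg gf i.
have [d] := ubnP (i : nat); elim: d i => // d IHd i lt_id.
have [i' Ei] := fg i; have [i'' Ei'] := gf i.
case: (ltngtP i' i) => [lt_i'|lt_i|/val_inj E]; last by rewrite Ei E.
  have: f i = f i' by rewrite Ei IHd //; lia.
  by move/(increasing_inj f_mono) => E; rewrite E ltnn in lt_i'.
have lt_i'' : i'' < i by rewrite -(increasing_lt f_mono) -Ei' Ei g_mono.
have: g i = g i'' by rewrite Ei' IHd //; lia.
by move/(increasing_inj g_mono) => E; rewrite -E ltnn in lt_i''.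
Qed.

Lemma enum_val_mono m (A : {set 'I_m}) :
  {homo (@enum_val _ (mem A)) : i j / (i < j)%N >-> (i < j)%N}.
Proof.
move=> i j lt_ij; have lt_jA : j < size (enum A) by rewrite -cardE.
have sA : sorted ltn (map val (enum A)).
  rewrite (subseq_sorted ltn_trans (map_subseq _ (filter_subseq _ _))) //.
  by rewrite -[X in map _ X](enumT 'I_m) val_enum_ord iota_ltn_sorted.
have x0 := enum_val i; rewrite !(enum_val_nth x0).
have := sorted_ltn_nth ltn_trans 0 sA.
move=> /(_ (i : nat) (j : nat)); rewrite !inE size_map.
move=> /(_ (ltn_trans lt_ij lt_jA) lt_jA lt_ij).
by rewrite !(nth_map x0) // (ltn_trans lt_ij).
Qed.
End Increasing.

Section Merges.
Local Open Scope nat_scope.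
Variables n k : nat.
Local Notation T := ('I_n + 'I_k)%type.
Implicit Types (s : 'S_(n + k)) (pos : T -> 'I_(n + k)) (a b : 'I_k -> nat).

Definition is_upper (u : T) : bool := if u is inl _ then true else false.

Lemma order_iso_code_uniq a a' pos :
  order_iso a pos -> order_iso a' pos ->
  (forall j, a j <= n) -> (forall j, a' j <= n) -> a =1 a'.
Proof.
move=> iso iso' le_a le_a' j.
have E (i : 'I_n) : (i < a j) = (i < a' j).
  by rewrite -[LHS]/(before a (inl i) (inr j)) iso -iso'.
case: (ltngtP (a j) (a' j)) => // lt_a.
  by have := E (Ordinal (leq_trans lt_a (le_a' j))); rewrite /= lt_a ltnn.
by have := E (Ordinal (leq_trans lt_a (le_a j))); rewrite /= lt_a ltnn.
Qed.

Section Realized.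
Variables (s : 'S_(n + k)) (a b : 'I_k -> nat) (pos : T -> 'I_(n + k)).
Hypotheses (isoa : order_iso a pos) (isob : order_iso b (fun u => s (pos u))).

(** Along [pos], contiguous subwords on an interval of values are the blocks. *)
Lemma irreducible_blockless : absolutely_irreducible s <-> blockless n a b.
Proof.
have [g posK gK] := order_iso_bij isoa; have inj := order_iso_inj isoa.
have onto x : exists u, x = pos u by exists (g x); rewrite gK.
split=> [/abs_irreducibleP irr X bX u v uX vX neq w | nb].
  rewrite -(mem_imset _ _ inj).
  apply: (irr (pos @: X) _ (pos u) (pos v));
    rewrite ?mem_imset ?(inj_eq inj) //.
  move=> x y z.
  have [x' ->] := onto x; have [y' ->] := onto y; have [z' ->] := onto z.
  by rewrite !mem_imset // -!isoa -!isob => yX xX zX; apply: bX.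
apply/abs_irreducibleP => Z Zc x y.
have [u ->] := onto x; have [v ->] := onto y => uZ vZ neq z.
have [w ->] := onto z.
have preE t : (t \in pos @^-1: Z) = (pos t \in Z) by rewrite inE.
rewrite -preE; apply: (nb (pos @^-1: Z) _ u v); rewrite ?inE //; last first.
  by apply: contraNneq neq => ->.
move=> u' v' w'; rewrite !inE => v'X u'X w'X.
by rewrite !isoa !isob; apply: Zc.
Qed.

Hypothesis diag : forall j, b j < a j.
Hypothesis a_le : forall j, a j <= n.

Lemma ltr_maxima_upper u : (pos u \in ltr_maxima s) = is_upper u.
Proof.
have [g posK gK] := order_iso_bij isoa.
rewrite inE; case: u => [i|j] /=.
  apply/forallP => y; apply/implyP; rewrite -[y]gK -isoa -isob.
  by case: (g y) => [i'|j] //= le_ai; apply: leq_trans le_ai; apply: ltnW.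
apply/negbTE/forallPn;
  exists (pos (inl (Ordinal (leq_trans (diag j) (a_le j))))).
by rewrite negb_imply -isoa -isob /= diag ltnn.
Qed.

Lemma avoids321_merge : avoids321 s.
Proof.
have [g posK gK] := order_iso_bij isoa.
apply/negP => /existsP[x /existsP[y /existsP[z]]].
rewrite -[x]gK -[y]gK -[z]gK => /and4P[lt_xy lt_yz gt_xy gt_yz].
have := ltn_trans lt_xy lt_yz; have := ltn_trans gt_yz gt_xy.
move: lt_xy lt_yz gt_xy gt_yz; rewrite -!isoa -!isob.
by case: (g x) (g y) (g z) => [u|u] [v|v] [w|w] /=; lia.
Qed.

Lemma not_excluded_merge : 0 < k -> ~~ excluded s.
Proof.
move=> k_gt0; pose j := Ordinal k_gt0.
have n_gt0 : 0 < n by apply: leq_ltn_trans (leq0n _) (leq_trans (diag j) (a_le j)).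
rewrite /excluded; apply/norP; split; first by lia.
apply/norP; split; first by lia.
rewrite negb_and; apply/orP; right; apply/eqP => s1.
pose i := Ordinal (leq_trans (diag j) (a_le j)).
have: before a (inl i) (inr j) by apply: diag.
have: ~~ before b (inl i) (inr j) by rewrite /= ltnn.
by rewrite isoa isob s1 !perm1 => /negbTE ->.
Qed.

Lemma irr321_merge : 0 < k -> reduced_polyomino n a b -> irr321 s.
Proof.
move=> k_gt0 rp; rewrite /irr321 avoids321_merge not_excluded_merge // !andbT.
by apply/irreducible_blockless/polyomino_blockless.
Qed.
End Realized.

Lemma card_upper s pos : bijective pos ->
    (forall u, (pos u \in ltr_maxima s) = is_upper u) ->
  #|ltr_maxima s| = n /\ #|~: ltr_maxima s| = k.
Proof.
move=> [g posK gK] up; have inj := can_inj posK.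
have E : #|ltr_maxima s| = n.
  have -> : ltr_maxima s = [set pos (inl i) | i : 'I_n].
    apply/setP => x; rewrite -[x]gK up; apply/idP/imsetP => [|[i _ /inj ->]] //.
    by case: (g x) => // i _; exists i.
  by rewrite card_imset ?card_ord // => i i' /inj[].
by split=> //; have := cardsC (ltr_maxima s); rewrite E card_ord; lia.
Qed.

(** Take the largest value to the left of [x]. *)
Lemma nonmax_below_max m (t : 'S_m) (x : 'I_m) : x \notin ltr_maxima t ->
  exists y, [/\ y \in ltr_maxima t, y < x & t x < t y].
Proof.
rewrite inE => /forallPn[y0]; rewrite negb_imply => /andP[lt_y0 ge_y0].
case: (@arg_maxnP _ y0 (fun y => y < x) (fun y => t y) lt_y0) => y lt_yx ymax.
have {}ymax (z : 'I_m) : z < x -> t z <= t y by move=> lt_z; apply: ymax.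
exists y; split=> //.
  rewrite inE; apply/forallP => z; apply/implyP => lt_zy.
  rewrite ltn_neqAle ymax ?(ltn_trans lt_zy) // andbT.
  by rewrite val_eqE (inj_eq perm_inj) -val_eqE neq_ltn lt_zy.
rewrite -leqNgt in ge_y0; have := leq_trans ge_y0 (ymax _ lt_y0).
rewrite leq_eqVlt => /predU1P[/val_inj/perm_inj E|//].
by rewrite E ltnn in lt_yx.
Qed.

(** The positions of the maxima and of the others, both enumerated
increasingly, give the first shuffle; the values of the maxima increase by
definition and those of the others by 321-avoidance, which gives the second
one. *)
Lemma irr321_codes s :
    irr321 s -> #|ltr_maxima s| = n -> #|~: ltr_maxima s| = k ->
  exists a b pos,
    [/\ order_iso a pos, order_iso b (fun u => s (pos u)),
        forall j, a j <= n /\ b j <= n, 0 < k & reduced_polyomino n a b].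
Proof.
move=> /and3P[irr av nexcl] En Ek; set M := ltr_maxima s in En Ek.
pose pos (u : T) : 'I_(n + k) := match u with
  | inl i => enum_val (cast_ord (esym En) i)
  | inr j => enum_val (cast_ord (esym Ek) j) end.
have posl (i : 'I_n) : pos (inl i) \in M by exact: enum_valP.
have posr (j : 'I_k) : pos (inr j) \notin M.
  by rewrite -in_setC; exact: (enum_valP (cast_ord (esym Ek) j)).
have mono_l (i i' : 'I_n) : i < i' -> pos (inl i) < pos (inl i').
  by move=> lt_i; apply: enum_val_mono.
have mono_r (j j' : 'I_k) : j < j' -> pos (inr j) < pos (inr j').
  by move=> lt_j; apply: enum_val_mono.
have inj : injective pos.
  move=> [i|j] [i'|j'] E.
  - by move/enum_val_inj/cast_ord_inj: E => ->.
  - by have := posr j'; rewrite -E posl.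
  - by have := posr j; rewrite E posl.
  - by move/enum_val_inj/cast_ord_inj: E => ->.
have [a isoa a_le] := order_iso_of_mono inj mono_l mono_r.
have [g posK gK] := order_iso_bij isoa.
have [b isob b_le] : exists2 b : 'I_k -> nat,
    order_iso b (fun u => s (pos u)) & forall j, b j <= n.
  apply: order_iso_of_mono.
  - by move=> u v /perm_inj/inj.
  - by move=> i i' /mono_l lt_i; move: (posl i');
    rewrite inE => /forallP/(_ _)/implyP; apply.
  - move=> j j' /mono_r lt_j; rewrite ltnNge; apply/negP => le_s.
    have [y [_ lt_y gt_y]] := nonmax_below_max (posr j).
    case/negP: av; apply/existsP; exists y; apply/existsP; exists (pos (inr j)).
    apply/existsP; exists (pos (inr j'));
      rewrite lt_y gt_y lt_j ltn_neqAle le_s andbT.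
    by rewrite val_eqE (inj_eq perm_inj) -val_eqE neq_ltn lt_j orbT.
have diag j : b j < a j.
  have [y [yM lt_y gt_y]] := nonmax_below_max (posr j).
  move: yM lt_y gt_y; rewrite -[y]gK; case: (g y) => [i|j'] yM; last first.
    by rewrite (negbTE (posr j')) in yM.
  rewrite -isoa /= => lt_ia gt_y; apply: leq_ltn_trans lt_ia.
  by rewrite leqNgt -[_ < _]/(before b (inl i) (inr j)) isob -leqNgt ltnW.
have nb : blockless n a b by apply/(irreducible_blockless isoa isob).
have k_gt0 : 0 < k.
  rewrite lt0n; apply: contra nexcl => /eqP k0.
  (* Without other entries both shuffles are trivial and s is the identity; for
     n > 2 its first two entries form a block. *)
  have none (j : 'I_k) : False by case: j => d; rewrite k0.
  have iso1 : order_iso a (fun u => s (pos u)).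
    by move=> [i|j] [i'|j']; rewrite -isob //; case: none.
  have s1 : s = 1%g.
    apply/permP => x; rewrite perm1 -[x]gK.
    by rewrite (order_iso_uniq iso1 isoa).
  rewrite /excluded s1 eqxx andbT; apply/negPn/negP => big_n.
  have lt2n : 2 < n by lia.
  pose o d (lt_d : d < 3) : 'I_n := Ordinal (leq_trans lt_d lt2n).
  suff: inl (o 2 isT) \in [set (inl (o 0 isT) : T); inl (o 1 isT)].
    by rewrite !inE.
  apply: (nb _ _ (inl (o 0 isT)) (inl (o 1 isT))); rewrite ?inE ?eqxx ?orbT //.
  move=> u [v|j] w; last by case: none.
  by rewrite !inE => _ /orP[]/eqP-> /orP[]/eqP-> /=; lia.
exists a, b, pos; split=> //.
apply: blockless_polyomino => //; first exact: order_iso_mono isoa a_le.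
exact: order_iso_mono isob b_le.
Qed.

End Merges.

Section CodeTuples.
Local Open Scope nat_scope.
Local Notation row n := ('I_n.+1 * 'I_n.+1)%type.

Definition right_end n k (c : k.-tuple (row n)) (j : 'I_k) : nat := (tnth c j).1.
Definition left_end n k (c : k.-tuple (row n)) (j : 'I_k) : nat := (tnth c j).2.

Lemma is_codeP n (c : seq (row n)) (x0 : row n) :
  is_code c <->
  [/\ 0 < size c, (nth x0 c 0).2 = 0 :> nat, 0 < (nth x0 c 0).1,
      forall i, i.+1 < size c -> row_step (nth x0 c i) (nth x0 c i.+1)
    & (nth x0 c (size c).-1).1 = n :> nat].
Proof.
case: c => [|r c] /=; first by split=> // -[].
rewrite [nth x0 (r :: c) _](nth_last x0 (r :: c)) /=.
split=> [/and4P[/eqP b0 a0 /(pathP x0) st /eqP la]|].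
  by split.
by case=> _ b0 a0 st la; apply/and4P; split=> //;
  [apply/eqP|apply/(pathP x0)|apply/eqP].
Qed.

(** With [q = n.-1], all interior boundaries are hit, and codes are exactly the
reduced polyominoes. *)
Lemma codesP n k (c : k.-tuple (row n)) :
  c \in codes n n.-1 k <-> 0 < k /\ reduced_polyomino n (right_end c) (left_end c).
Proof.
pose x0 : row n := (ord0, ord0).
have nthE (j : 'I_k) : nth x0 c j = tnth c j by rewrite (tnth_nth x0).
rewrite inE; split=> [/andP[/(is_codeP _ x0)]|
  [k_gt0 [mono overlap first_ last_ rows_ cols_]]].
  rewrite size_tuple => -[k_gt0 b0 a0 st la] hits; split=> //.
  have step (i j : 'I_k) : j = i.+1 :> nat -> row_step (tnth c i) (tnth c j).
    by move=> ji; rewrite -!nthE ji; apply: st; rewrite -ji.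
  have mono (j j' : 'I_k) : j <= j' ->
      right_end c j <= right_end c j' /\ left_end c j <= left_end c j'.
    move=> le_j; pose leT (r r' : row n) := (r.1 <= r'.1) && (r.2 <= r'.2).
    apply/andP; rewrite /right_end /left_end -!nthE -/(leT _ _).
    apply: (@sorted_leq_nth _ leT); rewrite ?inE ?size_tuple //.
    - by move=> y x z /andP[h1 h2] /andP[h3 h4];
      rewrite /leT (leq_trans h1) ?(leq_trans h2).
    - by move=> x; rewrite /leT !leqnn.
    - apply/(sortedP x0) => i; rewrite size_tuple => /st /and4P[h1 h2 _ _].
      by rewrite /leT h1 h2.
  have diag j : left_end c j < right_end c j.
    have [j0|j_gt0] := posnP j;
      first by rewrite /right_end /left_end -!nthE j0 b0.
    have lt_i : j.-1 < k by apply: leq_ltn_trans (leq_pred j) (ltn_ord j).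
    have /step/and4P[le_a _ lt_ba _] : j = (Ordinal lt_i).+1 :> nat by rewrite /= prednK.
    exact: leq_trans lt_ba le_a.
  split=> //.
  - move=> i j; rewrite leq_eqVlt => /predU1P[/step/and4P[]//|le_ji].
    by have [_ le_b] := mono j i le_ji; apply: leq_ltn_trans le_b (diag i).
  - by move=> j j0; rewrite /left_end -nthE j0.
  - by move=> j jk; rewrite /right_end -nthE -[val j]/(j.+1.-1) jk.
  - move=> i j /step/and4P[_ _ _ /negP neq] [Ea Eb]; apply: neq.
    by rewrite -pair_eqE /pair_eq /= -!val_eqE; apply/andP; split; apply/eqP.
  - move=> i i_n; move/allP/(_ i): hits; rewrite mem_iota => hit_i.
    have /hasP[r rc] : hit c i by apply: hit_i; lia.
    by have /tnthP[j ->] := rc; move=> /orP[]/eqP E; exists j; [left|right].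
apply/andP; split.
  apply/(is_codeP _ x0); rewrite size_tuple.
  have E0 := nthE (Ordinal k_gt0); have lt_l : k.-1 < k by rewrite prednK.
  have El := nthE (Ordinal lt_l); rewrite /= in E0 El.
  split=> //; rewrite ?E0 ?El.
  - exact: first_.
  - by apply: leq_ltn_trans (overlap (Ordinal k_gt0) (Ordinal k_gt0) _).
  - move=> i lt_i1; have lt_i := ltnW lt_i1.
    rewrite (nthE (Ordinal lt_i)) (nthE (Ordinal lt_i1)).
    have [le_a le_b] := mono (Ordinal lt_i) (Ordinal lt_i1) (leqnSn _).
    apply/and4P; split=> //; first exact: overlap.
    by apply/eqP => E; apply: (rows_ (Ordinal lt_i) (Ordinal lt_i1));
      rewrite // /right_end /left_end E.
  - by apply: last_; rewrite /= prednK.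
apply/allP => i; rewrite mem_iota => i_n.
have [|j Ej] := cols_ i; first by lia.
apply/hasP; exists (tnth c j); first exact: mem_tnth.
by case: Ej => E; apply/orP; [left|right]; apply/eqP.
Qed.

(** A permutation and a code correspond when the code shuffles maxima and others
into the positions and into the values of the permutation. Shuffles determine
the permutation; conversely the positions of the maxima determine the first
shuffle and their values the second. *)
Lemma card_irr321 n k :
  #|[set s : 'S_(n + k) | [&& irr321 s, #|ltr_maxima s| == n
                               & #|~: ltr_maxima s| == k]]| = #|codes n n.-1 k|.
Proof.
set A := [set s | _].
pose r (s : 'S_(n + k)) (c : k.-tuple (row n)) := exists pos,
  order_iso (right_end c) pos /\ order_iso (left_end c) (fun u => s (pos u)).
have right_end_le (c : k.-tuple (row n)) j : right_end c j <= n by rewrite -ltnS ltn_ord.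
have left_end_le (c : k.-tuple (row n)) j : left_end c j <= n by rewrite -ltnS ltn_ord.
apply/eqP; rewrite eqn_leq; apply/andP; split.
  apply: (leq_card_rel (r := r)) =>
    [s|s s' c _ _ _ [pos [isoa isob]] [pos' [isoa' isob']]].
    rewrite inE => /and3P[irr /eqP En /eqP Ek].
    have [a [b [pos [isoa isob le_n k_gt0 rp]]]] := irr321_codes irr En Ek.
    pose c := [tuple (inord (a j), inord (b j)) : row n | j < k].
    have aE : right_end c = a.
      by apply/funext => j; rewrite /right_end tnth_mktuple inordK // ltnS;
        case: (le_n j).
    have bE : left_end c = b.
      by apply/funext => j; rewrite /left_end tnth_mktuple inordK // ltnS;
        case: (le_n j).
    exists c; first by apply/codesP; rewrite aE bE.
    by exists pos; rewrite aE bE.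
  apply/permP => x; have [g posK gK] := order_iso_bij isoa.
  by rewrite -[x]gK (order_iso_uniq isob isob') (order_iso_uniq isoa isoa').
apply: (leq_card_rel (r := fun c s => r s c)) => [c|c c' s].
  move/codesP=> [k_gt0 rp].
  have [pos isoa] : exists pos : 'I_n + 'I_k -> _, order_iso (right_end c) pos.
    by apply: (@order_iso_ex n k) => j j' /(rp_mono rp)[].
  have [ht isob] : exists ht : 'I_n + 'I_k -> _, order_iso (left_end c) ht.
    by apply: (@order_iso_ex n k) => j j' /(rp_mono rp)[].
  have [g posK gK] := order_iso_bij isoa.
  have inj_s : injective (fun x => ht (g x)).
    by move=> x y /(order_iso_inj isob)/(can_inj gK).
  have isob' : order_iso (left_end c) (fun u => perm inj_s (pos u)).
    by move=> u v; rewrite !permE !posK.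
  have diag j : left_end c j < right_end c j by apply: (rp_overlap rp).
  exists (perm inj_s); last by exists pos.
  have [En Ek] := card_upper (order_iso_bij isoa)
    (ltr_maxima_upper isoa isob' diag (right_end_le c)).
  by rewrite inE En Ek !eqxx !andbT; apply: (irr321_merge isoa isob').
move=> /codesP[_ rp] /codesP[_ rp'] _ [pos [isoa isob]] [pos' [isoa' isob']].
have up := ltr_maxima_upper isoa isob
  (fun j => rp_overlap rp (leqnSn j)) (right_end_le c).
have up' := ltr_maxima_upper isoa' isob'
  (fun j => rp_overlap rp' (leqnSn j)) (right_end_le c').
have [g posK gK] := order_iso_bij isoa;
  have [g' posK' gK'] := order_iso_bij isoa'.
have posE : pos =1 pos'.
  have El : (fun i => pos (inl i)) =1 (fun i => pos' (inl i)).
    apply: increasing_uniq => [i j lt_ij|i j lt_ij|i|i];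
      rewrite -?isoa -?isoa' //.
    - have := up' (g' (pos (inl i))); rewrite gK' up.
      by case E : (g' _) => [i'|//] _; exists i'; rewrite -E gK'.
    - have := up (g (pos' (inl i))); rewrite gK up'.
      by case E : (g _) => [i'|//] _; exists i'; rewrite -E gK.
  have Er : (fun j => pos (inr j)) =1 (fun j => pos' (inr j)).
    apply: increasing_uniq => [i j lt_ij|i j lt_ij|i|i];
      rewrite -?isoa -?isoa' //.
    - have := up' (g' (pos (inr i))); rewrite gK' up.
      by case E : (g' _) => [//|i'] _; exists i'; rewrite -E gK'.
    - have := up (g (pos' (inr i))); rewrite gK up'.
      by case E : (g _) => [//|i'] _; exists i'; rewrite -E gK.
  by case.
have Ea : right_end c =1 right_end c'.
  apply: (order_iso_code_uniq isoa) => // u v; rewrite !posE; exact: isoa'.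
have Eb : left_end c =1 left_end c'.
  apply: (order_iso_code_uniq isob) => // u v; rewrite !posE; exact: isob'.
apply: eq_from_tnth => j; have := Ea j; have := Eb j;
  rewrite /right_end /left_end.
by case: (tnth c j) (tnth c' j) => [x y] [x' y'] /= /val_inj -> /val_inj ->.
Qed.
End CodeTuples.

(** Each boundary that must be hit multiplies the series by 1 - x, by
[card_codesS]; the interior boundaries are 1, ..., n - 1. *)
Lemma coef_codes n q k : (q < n)%N || (q == 0%N) ->
  (#|codes n q k|)%:R = fps_coef (fps_coef ((1 - varX) ^+ q * row_reduced) n) k.
Proof.
elim: q n => [|q IHq] n;
  first by rewrite expr0 mul1r coef_row_reduced card_codes0; case: k.
rewrite orbF; case: n => // n; rewrite ltnS => lt_qn.
rewrite exprS mulrBl mul1r mulrBl !fps_coefB -[varX * _ * _]mulrA fps_coefXM.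
rewrite -!IHq ?lt_qn ?ltnS ?(ltnW lt_qn) // -(card_codesS _ lt_qn) natrD addrK //.
Qed.

Lemma Airr_collapse : Airr = collapse row_reduced.
Proof.
apply: fpsP => n; apply: fpsP => k; rewrite coef_collapse -coef_codes.
  by rewrite -card_irr321.
by case: n => [|n]; rewrite ?eqxx ?orbT ?ltnSn.
Qed.

(** The equation of [row_reduced] under the substitution of x' = x / (1 + x),
from which x' is cleared by multiplying by 1 + x. *)
Lemma Airr_fixpoint :
  Airr = (1 + varX) * (1 + varY) * Airr ^+ 2 + varX * varY * Airr
         + varX * varY.
Proof.
have elim_x (S : comNzRingType) (x x' y A : S) : (1 + x) * x' = x ->
    (1 + y) * A = (x' + A) * (y + (1 + y) * A) ->
  A = (1 + x) * (1 + y) * A ^+ 2 + x * y * A + x * y.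
  move=> Ex EA; apply/eqP; rewrite -subr_eq0; apply/eqP.
  transitivity ((1 + x) * ((1 + y) * A) -
    ((1 + x) * x' + (1 + x) * A) * (y + (1 + y) * A)); first by rewrite Ex; ring.
  transitivity ((1 + x) * ((1 + y) * A - (x' + A) * (y + (1 + y) * A))).
    by ring.
  by rewrite -EA subrr mulr0.
have CY f : collapse (varY * f) = varY * collapse f by apply: collapseC.
have CY1 f : collapse ((1 + varY) * f) = (1 + varY) * collapse f.
  by rewrite !mulrDl !mul1r collapseD CY.
have CY0 : collapse varY = varY by rewrite -[varY in LHS]mulr1 CY collapse1 mulr1.
rewrite Airr_collapse; apply: (elim_x _ varX (collapse varX)).
  have -> : collapse varX = collapse (varX * 1) by rewrite mulr1.
  by rewrite collapseX collapse1 mulr1.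
have := congr1 (@collapse _) row_reduced_eq.
by rewrite CY1 collapseM !collapseD CY0 CY1.
Qed.

Lemma Airr1_fixpoint :
  Airr1 = (1 + fpsX int) * (1 + fpsX int) * Airr1 ^+ 2
          + fpsX int * fpsX int * Airr1 + fpsX int * fpsX int.
Proof.
rewrite {1}/Airr1 {1}Airr_fixpoint !expr2 !(diagD, diagM) diag1.
by rewrite [fps_diag varX]diagX [fps_diag varY]diagC.
Qed.

Lemma card_irr321_cast m m' (P : forall i, 'S_i -> bool) : m = m' ->
  #|[set s : 'S_m | P m s]| = #|[set s : 'S_m' | P m' s]|.
Proof. by move=> ->. Qed.

Lemma coef_Airr1 m : fps_coef Airr1 m = (#|[set s : 'S_m | irr321 s]|)%:R.
Proof.
rewrite [LHS]/= -natr_sum; congr (_%:R).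
transitivity (\sum_(i < m.+1)
    #|[set s : 'S_m | irr321 s & #|ltr_maxima s| == i]|)%N.
  apply: eq_bigr => i _.
  rewrite (@card_irr321_cast _ m (fun l (s : 'S_l) => [&& irr321 s,
    #|ltr_maxima s| == i & #|~: ltr_maxima s| == (m - i)%N])); last first.
    by rewrite subnKC // -ltnS.
  apply: eq_card => s; rewrite !inE; congr (_ && _).
  have := cardsC (ltr_maxima s); rewrite card_ord; have := ltn_ord i; lia.
have max_lt (s : 'S_m) : (#|ltr_maxima s| < m.+1)%N.
  by rewrite ltnS -[leqRHS]card_ord max_card.
rewrite -sum1dep_card (partition_big (fun s => Ordinal (max_lt s)) predT) //=.
by apply: eq_bigr => i _; rewrite -sum1dep_card.
Qed.

Theorem mainTheorem3 :
  (1 + varX) * (1 + varY) * Airr ^+ 2 + (varX * varY - 1) * Airr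
    + varX * varY = 0
  /\ (forall m : nat,
        fps_coef Airr1 m = (#|[set s : 'S_m | irr321 s]|)%:R)
  /\ (fpsX int + 1) ^+ 2 * Airr1 ^+ 2 + (fpsX int ^+ 2 - 1) * Airr1
       + fpsX int ^+ 2 = 0.
Proof.
have move_over (S : comNzRingType) (x y A : S) :
    A = (1 + x) * (1 + y) * A ^+ 2 + x * y * A + x * y ->
  (1 + x) * (1 + y) * A ^+ 2 + (x * y - 1) * A + x * y = 0.
  move=> EA; transitivity ((1 + x) * (1 + y) * A ^+ 2 + x * y * A + x * y - A).
    by ring.
  by rewrite -EA subrr.
split; first exact: move_over Airr_fixpoint.
split; first exact: coef_Airr1.
by have := move_over _ _ _ _ Airr1_fixpoint;
  rewrite -!expr2 [1 + fpsX int]addrC.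
Qed.
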